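(* Let $r>0$ and $\beta,\theta\in(0,1)$. (i) The thinning operator $(\beta,\theta)\star(\cdot)$ obtained by prespecifying the marginal distribution $X_t\sim NB1(r,\theta)$ and the innovation distribution $\varepsilon_t\sim NB1(r,(1-\beta)\theta)$ of a stationary INAR(1) process, that is, the one whose counting pgf is $\Psi_G(s)=\Psi_X^{-1}\big(\Psi_X(s)/\Psi_\varepsilon(s)\big)$, is characterized by $$\Psi_G(s)=\Psi_{\beta,\theta}(s)=1-\beta\,\frac{1-s}{1-(1-\beta)\theta s}.$$ Therefore the thinning operators $(\beta,\theta)\odot(\cdot)$ and $(\beta,\theta)\star(\cdot)$ are identical. (ii) For $\alpha\in(0,1)$ and $\mu>0$, the thinning operator $(\alpha,\mu,r)\star(\cdot)$ coincides with the thinning operator $(\beta,\theta)\star(\cdot)$ (equivalently $(\beta,\theta)\odot(\cdot)$) with $$\beta=\frac{\alpha r}{r+(1-\alpha)\mu}\quad\text{and}\quad\theta=\frac{\mu}{\mu+r}.$$ Conversely, for $\beta,\theta\in(0,1)$, the operator $(\beta,\theta)\star(\cdot)$ (equivalently $(\beta,\theta)\odot(\cdot)$) coincides with $(\alpha,\mu,r)\star(\cdot)$ with $$\alpha=\frac{\beta}{1-(1-\beta)\theta}\quad\text{and}\quad\mu=\frac{\theta r}{1-\theta}.$$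
   Context: $\mathbb{Z}_+=\{0,1,2,\dots\}$; pgf means probability generating function. A thinning operator acts on a $\mathbb{Z}_+$-valued random variable $X$ as $\sum_{i=1}^{X}G_i$, with $(G_i)_{i\ge1}$ i.i.d. $\mathbb{Z}_+$-valued and independent of $X$; it is characterized by the common pgf $\Psi_G$ of the $G_i$, and two thinning operators are identical when their pgf's $\Psi_G$ coincide. $NB1(r,\theta)$ is the distribution on $\mathbb{Z}_+$ with pgf $\left(\frac{1-\theta}{1-\theta s}\right)^r$. A stationary INAR(1) process $X_{t+1}=\sum_{i=1}^{X_t}G_i+\varepsilon_{t+1}$ with marginal pgf $\Psi_X$ and innovation pgf $\Psi_\varepsilon$ satisfies $\Psi_X(s)=\Psi_X[\Psi_G(s)]\Psi_\varepsilon(s)$; prespecifying $\Psi_X$ and $\Psi_\varepsilon$, one defines the operator $\star$ by $\Psi_G(s)=\Psi_X^{-1}(\Psi_X(s)/\Psi_\varepsilon(s))$. The operator $(\beta,\theta)\odot(\cdot)$ is the thinning operator whose counting pgf is $\Psi_{\beta,\theta}(s)=1-\beta\frac{1-s}{1-(1-\beta)\theta s}$. The operator $(\alpha,\mu,r)\star(\cdot)$ is the thinning operator whose counting pgf is $$1-\alpha\frac{1-s}{1+r^{-1}(1-\alpha)\mu(1-s)}.$$ *)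

(* Defs.v *)
From HB Require Import structures.
From mathcomp Require Import all_boot all_order all_algebra.
From mathcomp Require Import all_classical all_reals all_analysis.

Set Implicit Arguments.
Unset Strict Implicit.
Unset Printing Implicit Defensive.

Import Order.TTheory GRing.Theory Num.Theory.
Local Open Scope classical_set_scope.
Local Open Scope ring_scope.

(* Laws on {0, 1, 2, ...} are probability measures on nat with its discrete
   sigma-algebra.  Probability generating functions are compared on [0, 1]:
   this determines the law, and on [0, 1] a nondegenerate pgf is strictly
   increasing, hence has the inverse pgf_inv. *)

Definition pgf (R : realType) (P : probability nat R) (s : R) : R :=
  fine 'E_P[fun k : nat => s ^+ k].

(* "The" law with pgf psi: if no law has this pgf, the value is the default
   point of [probability nat R], a Dirac mass. *)
Definition law_with_pgf (R : realType) (psi : R -> R) : probability nat R :=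
  get [set P : probability nat R | forall s, 0 <= s <= 1 -> pgf P s = psi s].

(* Inverse of the restriction of the pgf to [0, 1]; 0 outside its range. *)
Definition pgf_inv (R : realType) (P : probability nat R) : R -> R :=
  'pinv_(fun=> 0) `[0, 1] (pgf P).

Definition NB1 (R : realType) (r theta : R) : probability nat R :=
  law_with_pgf (fun s => ((1 - theta) / (1 - theta * s)) `^ r).

(* The operator sending X to the sum of X i.i.d. counting variables
   independent of X is given by the law of these counting variables. *)
Record thinning (R : realType) := Thinning {
  counting_law : probability nat R
}.

Definition counting_pgf (R : realType) (T : thinning R) : R -> R :=
  pgf (counting_law T).

Definition thinning_with_pgf (R : realType) (psi : R -> R) : thinning R :=
  Thinning (law_with_pgf psi).

Definition identical (R : realType) (T1 T2 : thinning R) : Prop :=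
  forall s : R, 0 <= s <= 1 -> counting_pgf T1 s = counting_pgf T2 s.

(* Solution Psi_G of the stationary INAR(1) equation
   Psi_X(s) = Psi_X(Psi_G(s)) Psi_eps(s). *)
Definition star_pgf (R : realType) (PX Peps : probability nat R) (s : R) : R :=
  pgf_inv PX (pgf PX s / pgf Peps s).

Definition star (R : realType) (PX Peps : probability nat R) : thinning R :=
  thinning_with_pgf (star_pgf PX Peps).

(* (beta, theta) * (.); the parameter r of the prespecified laws, implicit in
   the usual notation, is kept as an argument. *)
Definition star_NB1 (R : realType) (r beta theta : R) : thinning R :=
  star (NB1 r theta) (NB1 r ((1 - beta) * theta)).

Definition odot_pgf (R : realType) (beta theta s : R) : R :=
  1 - beta * ((1 - s) / (1 - (1 - beta) * theta * s)).

Definition odot (R : realType) (beta theta : R) : thinning R :=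
  thinning_with_pgf (odot_pgf beta theta).

(* (alpha, mu, r) * (.) *)
Definition star3_pgf (R : realType) (alpha mu r s : R) : R :=
  1 - alpha * ((1 - s) / (1 + r^-1 * (1 - alpha) * mu * (1 - s))).

Definition star3 (R : realType) (alpha mu r : R) : thinning R :=
  thinning_with_pgf (star3_pgf alpha mu r).

(* Main.v *)
(* The substance is that the laws in play exist, so that [law_with_pgf] returns
   a law with the prescribed pgf and not its junk value.  For NB1 this is the
   negative binomial series: with a_r(k) = r (r + 1) ... (r + k - 1) / k! and
   f_r(x) = sum_k a_r(k) x^k, Pascal's rule gives (1 - x) f_{r+1} = f_r, while
   termwise differentiation gives f_r' = r f_{r+1}; hence f_r(x) (1 - x)^r is
   constant.  For odot the law is a zero-modified geometric one.
   With c = (1 - beta) theta and psi = Psi_{beta,theta}, the identity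
   (1 - theta psi(s)) (1 - c s) = (1 - c) (1 - theta s) says that
   Psi_X(s) / Psi_eps(s) = Psi_X(psi(s)), and psi(s) lies in [0, 1], where
   Psi_X is injective; so star_pgf and odot_pgf agree on [0, 1]. *)
Require Import Defs.
From HB Require Import structures.
From mathcomp Require Import all_boot all_order all_algebra.
From mathcomp Require Import all_classical all_reals all_analysis.
From mathcomp Require Import ring lra.
Set Implicit Arguments.
Unset Strict Implicit.
Unset Printing Implicit Defensive.
Import Order.TTheory GRing.Theory Num.Theory.
Import numFieldNormedType.Exports.
Local Open Scope ring_scope.

(** * Existence of laws with a prescribed generating series *)

Lemma exists_probability_pgf (R : realType) (p : nat -> R) (psi : R -> R) :
  (forall k, 0 <= p k) -> (series p @ \oo --> (1 : R))%classic ->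
  (forall s, 0 <= s <= 1 ->
    (series (fun k => p k * s ^+ k) @ \oo --> psi s)%classic) ->
  exists P : probability nat R, forall s, 0 <= s <= 1 -> pgf P s = psi s.
Proof.
move=> p_ge0 p_sum p_pgf.
pose m_ k : {measure set nat -> \bar R} := mscale (NngNum (p_ge0 k)) \d_k.
pose m : {measure set nat -> \bar R} := mseries m_ 0.
(* Carries limits of real partial sums over to the extended-real series produced by measures and
   integrals. *)
have limE (f : nat -> \bar R) (u : nat -> R) (l : R) :
    (forall k, f k = (u k)%:E) -> (series u @ \oo --> l)%classic ->
    (\sum_(0 <= k <oo) f k = l%:E)%E.
  move=> fu ul; under eq_eseriesr do rewrite fu.
  rewrite (_ : (fun n => _) = (EFin \o series u)); last first.
    by apply/funext => n /=; rewrite sumEFin.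
  by apply/cvg_lim => //; apply: cvg_EFin ul => //; exact: nearW.
have m1 : m setT = 1%E.
  rewrite /m /= /mseries; apply: limE p_sum => k.
  by rewrite /m_ /= /mscale /= diracT mule1.
(* [m] is already normalized; [mnormalize] only bundles it as a probability. *)
pose P : probability nat R := mnormalize m \d_0%N.
exists P => s s01; have s_ge0 : 0 <= s by case/andP: s01.
rewrite /pgf unlock (@eq_measure_integral _ _ _ _ m); last first.
  by move=> A _ _; rewrite /P /= /mnormalize m1 onee_eq0 /= invr1 mule1.
have sk_ge0 t : [set: nat]%classic t -> (0 <= (s ^+ t)%:E)%E.
  by rewrite lee_fin exprn_ge0.
rewrite ge0_integral_measure_series//.
rewrite (limE _ _ _ _ (p_pgf s s01))// => k.
rewrite ge0_integral_mscale// integral_dirac//.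
by rewrite diracT mul1e.
Qed.

(** Both functions cut out the same set of laws, and [get] depends only on that set; the equality
    thus covers the default value too. *)
Lemma eq_law_with_pgf (R : realType) (psi1 psi2 : R -> R) :
  (forall s, 0 <= s <= 1 -> psi1 s = psi2 s) ->
  law_with_pgf psi1 = law_with_pgf psi2.
Proof.
move=> psi12; rewrite /law_with_pgf; congr (get _); apply/seteqP.
by split=> P PE s s01; rewrite PE// psi12.
Qed.

(** At s = 1 the expansion of [psi] is the sum of the [p k], so [psi 1 = 1] supplies the
    normalization and [get] returns a genuine law. *)
Lemma pgf_law_with_pgf (R : realType) (p : nat -> R) (psi : R -> R) :
  (forall k, 0 <= p k) -> psi 1 = 1 ->
  (forall s, 0 <= s <= 1 ->
    (series (fun k => p k * s ^+ k) @ \oo --> psi s)%classic) ->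
  forall s, 0 <= s <= 1 -> pgf (law_with_pgf psi) s = psi s.
Proof.
move=> p_ge0 psi1 p_pgf; apply: (getPex (exists_probability_pgf p_ge0 _ p_pgf)).
have := p_pgf 1; rewrite psi1 ler01 lexx => /(_ isT).
by rewrite (_ : (fun k => _) = p)//; apply/funext => k; rewrite expr1n mulr1.
Qed.

(** * Negative binomial series; [nb_coef r k] is the binomial coefficient of r + k - 1 over k, for
    real r *)

Definition nb_coef (R : realType) (r : R) (k : nat) : R :=
  \prod_(i < k) ((r + i%:R) / i.+1%:R).

Lemma nb_coefS (R : realType) (r : R) k :
  k.+1%:R * nb_coef r k.+1 = (r + k%:R) * nb_coef r k.
Proof.
rewrite /nb_coef big_ord_recr/= mulrCA [X in _ * X]mulrC.
by rewrite divfK ?pnatr_eq0// mulrC.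
Qed.

Lemma nb_coef_ge0 (R : realType) (r : R) k : 0 <= r -> 0 <= nb_coef r k.
Proof. by move=> r_ge0; apply: prodr_ge0 => i _; rewrite divr_ge0// addr_ge0. Qed.

Lemma ler_nb_coef (R : realType) (r r' : R) k : 0 <= r -> r <= r' ->
  nb_coef r k <= nb_coef r' k.
Proof.
move=> r_ge0 rr'; apply: ler_prod => i _; apply/andP; split.
  by rewrite divr_ge0// addr_ge0.
by rewrite ler_pM2r ?invr_gt0// lerD2r.
Qed.

Lemma nb_coef1 (R : realType) k : nb_coef 1 k = 1 :> R.
Proof.
by rewrite /nb_coef big1// => i _; rewrite -natr1 addrC divff// gt_eqF// ltr_wpDl.
Qed.

(** Both sides are r (r + 1) ... (r + k) / k!. *)
Lemma nb_coef_addr1 (R : realType) (r : R) k :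
  r * nb_coef (r + 1) k = (r + k%:R) * nb_coef r k.
Proof.
elim: k => [|k IH]; first by rewrite /nb_coef !big_ord0 addr0.
have k1 : k.+1%:R != 0 :> R by rewrite pnatr_eq0.
apply: (mulfI k1); rewrite mulrCA nb_coefS mulrCA IH [RHS]mulrCA nb_coefS.
by rewrite -natr1; ring.
Qed.

Lemma pseries_diffs_nb_coef (R : realType) (r : R) :
  pseries_diffs (nb_coef r) = (fun k => r * nb_coef (r + 1) k).
Proof. by apply/funext => k; rewrite /pseries_diffs nb_coefS nb_coef_addr1. Qed.

Lemma nb_coef_pascal (R : realType) (r : R) k :
  nb_coef (r + 1) k.+1 = nb_coef (r + 1) k + nb_coef r k.+1.
Proof.
have k1 : k.+1%:R != 0 :> R by rewrite pnatr_eq0.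
(* After multiplication by k + 1, every term is a multiple of [nb_coef (r + 1) k]. *)
apply: (mulfI k1); rewrite mulrDr !nb_coefS -(nb_coef_addr1 r).
by rewrite -natr1; ring.
Qed.

(** Finite form of (1 - x) f_{r+1} = f_r, with one boundary term left by Pascal's rule. It serves to
    bound partial sums when the parameter grows by 1, and then to pass to the limit. *)
Lemma pseries_nb_coef_addr1 (R : realType) (r x : R) n :
  (1 - x) * pseries (nb_coef (r + 1)) x n.+1 =
  pseries (nb_coef r) x n.+1 - nb_coef (r + 1) n * x ^+ n.+1.
Proof.
elim: n => [|n IH].
  by rewrite /pseries /series /= !big_nat1 /nb_coef !big_ord0 expr1 expr0; ring.
have S (a : nat -> R) : pseries a x n.+2 = pseries a x n.+1 + a n.+1 * x ^+ n.+1.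
  by rewrite /pseries seriesSr.
by rewrite !S mulrDr IH nb_coef_pascal !exprS; ring.
Qed.

Lemma nondecreasing_pseries (R : realType) (a : nat -> R) (x : R) :
  (forall k, 0 <= a k) -> 0 <= x -> nondecreasing_seq (pseries a x).
Proof.
move=> a_ge0 x_ge0; apply: nondecreasing_series => k _ _.
by rewrite mulr_ge0// exprn_ge0.
Qed.

(* The coefficients increase with r, so it suffices to treat r = m + 1, by
   induction on m from the geometric series. *)
Lemma is_cvg_pseries_nb_coef (R : realType) (r x : R) :
  0 <= r -> 0 <= x -> x < 1 -> cvgn (pseries (nb_coef r) x).
Proof.
move=> r_ge0 x_ge0 x_lt1.
have main m : cvgn (pseries (nb_coef (m%:R + 1)) x).
  elim: m => [|m IH].
    apply/cvg_ex; exists (1 / (1 - x)).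
    rewrite /pseries; under eq_fun do rewrite add0r nb_coef1.
    by apply: cvg_geometric_series; rewrite ger0_norm.
  have a_ge0 k : 0 <= nb_coef (m.+1%:R + 1) k :> R by rewrite nb_coef_ge0// addr_ge0.
  apply: nondecreasing_is_cvgn; first exact: nondecreasing_pseries.
  exists ((1 - x)^-1 * limn (pseries (nb_coef (m%:R + 1)) x)) => _ [n _ <-].
  apply: (@le_trans _ _ (pseries (nb_coef (m.+1%:R + 1)) x n.+1)).
    exact: nondecreasing_pseries.
  rewrite ler_pdivlMl ?subr_gt0// -natr1 pseries_nb_coef_addr1.
  rewrite (@le_trans _ _ (pseries (nb_coef (m%:R + 1)) x n.+1))//.
    rewrite gerBl mulr_ge0// ?exprn_ge0//.
    by rewrite natr1.
  apply: nondecreasing_cvgn_le => //; apply: nondecreasing_pseries => // k.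
  by rewrite nb_coef_ge0// addr_ge0.
apply: series_le_cvg (main (Num.bound r)) => k.
- by rewrite mulr_ge0 ?exprn_ge0// nb_coef_ge0.
- by rewrite mulr_ge0 ?exprn_ge0// nb_coef_ge0// addr_ge0.
rewrite ler_wpM2r ?exprn_ge0// ler_nb_coef//.
have := archi_boundP r_ge0; lra.
Qed.

Lemma lim_pseries_nb_coef_addr1 (R : realType) (r x : R) :
  0 <= r -> 0 <= x -> x < 1 ->
  (1 - x) * limn (pseries (nb_coef (r + 1)) x) = limn (pseries (nb_coef r) x).
Proof.
move=> r_ge0 x_ge0 x_lt1.
have cv1 : cvgn (pseries (nb_coef (r + 1)) x).
  by apply: is_cvg_pseries_nb_coef => //; rewrite addr_ge0.
have cv := is_cvg_pseries_nb_coef r_ge0 x_ge0 x_lt1.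
have L : ((fun n => (1 - x) * pseries (nb_coef (r + 1)) x n.+1) @ \oo -->
   (1 - x) * limn (pseries (nb_coef (r + 1)) x))%classic.
  by apply: cvgMr; rewrite (cvg_shiftS (pseries _ _)).
(* The 0 is the limit of the general term of the convergent series for r + 1; the boundary term is x
   times that general term. *)
suff: (1 - x) * limn (pseries (nb_coef (r + 1)) x) =
    limn (pseries (nb_coef r) x) - x * 0 by rewrite mulr0 subr0.
apply: (cvg_unique _ L) => //=.
rewrite (_ : (fun n => _) = (fun n => pseries (nb_coef r) x n.+1 -
   x * (nb_coef (r + 1) n * x ^+ n))); last first.
  by apply/funext => n; rewrite pseries_nb_coef_addr1 exprS mulrCA.
apply: cvgB; [by rewrite (cvg_shiftS (pseries _ _))|apply: cvgMr].
exact: cvg_series_cvg_0.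
Qed.

Lemma is_derive_pseries_nb_coef (R : realType) (r x : R) : 0 <= r -> `|x| < 1 ->
  is_derive x 1 (fun y => limn (pseries (nb_coef r) y))
    (r * limn (pseries (nb_coef (r + 1)) x)).
Proof.
(* [K] is the midpoint of |x| and 1: differentiating termwise at x uses convergence of the series
   and of its first two formal derivatives at a point of larger modulus. *)
move=> r_ge0 x_lt1; pose K := (1 + `|x|) / 2.
have K_ge0 : 0 <= K by rewrite divr_ge0// addr_ge0.
have K_lt1 : K < 1 by rewrite /K; lra.
have cvK q : 0 <= q -> cvgn (pseries (nb_coef q) K).
  by move=> q_ge0; exact: is_cvg_pseries_nb_coef.
have pseriesZ (c : R) a y : pseries (fun k => c * a k) y = (fun n => c * pseries a y n).
  apply/funext => n; rewrite /pseries /series /= mulr_sumr.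
  by apply: eq_bigr => i _; rewrite mulrA.
have diffs2 : pseries_diffs (pseries_diffs (nb_coef r)) =
    (fun k => r * ((r + 1) * nb_coef (r + 1 + 1) k)).
  apply/funext => k; rewrite pseries_diffs_nb_coef /pseries_diffs mulrCA nb_coefS.
  by rewrite -nb_coef_addr1.
have r1 : 0 <= r + 1 by rewrite addr_ge0.
have r2 : 0 <= r + 1 + 1 by rewrite addr_ge0.
have cvd : cvgn (pseries (pseries_diffs (nb_coef r)) K).
  by rewrite pseries_diffs_nb_coef pseriesZ; apply: is_cvgMr; exact: cvK.
(* Here x may be negative, so convergence at x is inherited from [K]. *)
have cvx : cvgn (pseries (nb_coef (r + 1)) x).
  apply: is_cvg_pseries_inside (cvK _ r1) _; rewrite (ger0_norm K_ge0) /K; lra.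
have <- : limn (pseries (pseries_diffs (nb_coef r)) x) =
    r * limn (pseries (nb_coef (r + 1)) x).
  by rewrite pseries_diffs_nb_coef pseriesZ; apply/cvg_lim => //; exact: cvgMr.
apply: (@pseries_snd_diffs _ _ K) => //; first exact: cvK.
  rewrite diffs2 pseriesZ; apply: is_cvgMr.
  by rewrite pseriesZ; apply: is_cvgMr; exact: cvK.
by rewrite (ger0_norm K_ge0) /K; lra.
Qed.

Lemma lim_pseries_nb_coef (R : realType) (r x : R) : 0 < r -> 0 <= x -> x < 1 ->
  limn (pseries (nb_coef r) x) = (1 - x) `^ (- r).
Proof.
move=> r_gt0 x_ge0 x_lt1; have r_ge0 := ltW r_gt0.
pose f (y : R) := limn (pseries (nb_coef r) y).
pose g (y : R) := f y * (1 - y) `^ r.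
have dg (y : R) : 0 <= y -> y < 1 -> is_derive y 1 g 0.
  move=> y_ge0 y_lt1.
  have df : is_derive y 1 f (r * limn (pseries (nb_coef (r + 1)) y)).
    by apply: is_derive_pseries_nb_coef; rewrite ?ger0_norm.
  have y1 : 0 < 1 - y by rewrite subr_gt0.
  have dp : is_derive y 1 (fun z : R => (1 - z) `^ r) (- (r * (1 - y) `^ (r - 1))).
    have dl : is_derive y 1 (fun z : R => 1 - z) (- 1).
      by apply: is_derive_eq; ring.
    have := @is_derive1_comp R (fun z : R => z `^ r) (fun z => 1 - z) y _ _
      (@is_derive1_powR R r _ y1) dl.
    by rewrite /= mulrN1.
  apply: is_derive_eq; rewrite /GRing.scale /=.
  (* Once f_r and (1 - y)^r are written as (1 - y) f_{r+1} and (1 - y) (1 - y)^(r - 1), the two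
     terms of the product rule are opposite. *)
  rewrite {1}/f -lim_pseries_nb_coef_addr1//.
  rewrite -[X in _ + X * _](mulr_powRB1 (ltW y1) r_gt0).
  ring.
have f0 : f 0 = 1.
  (* The shift discards the empty partial sum; all others equal 1, the term k = 0. *)
  apply/cvg_lim => //; rewrite -(cvg_shiftS (pseries _ _)).
  rewrite (_ : (fun n => _) = (fun=> 1)); first exact: cvg_cst.
  apply/funext => n; rewrite /pseries /series /= big_nat_recl// /nb_coef big_ord0.
  by rewrite big1 ?addr0 ?mulr1// => i _; rewrite exprS mul0r mulr0.
have [c _] : exists2 c, c \in `[0, x] & g x - g 0 = 0 * (x - 0).
  apply: (@MVT_segment _ g (fun=> 0)) => // [y|].
    by rewrite in_itv /= => /andP[/ltW y0 yx]; apply: dg => //; exact: lt_trans x_lt1.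
  apply: derivable_within_continuous => y; rewrite in_itv /= => /andP[y0 yx].
  by apply: ex_derive; apply: dg => //; exact: le_lt_trans x_lt1.
rewrite mul0r => /eqP; rewrite subr_eq0 /g f0 subr0 powR1 mulr1 => /eqP fx.
have p_neq0 : (1 - x) `^ r != 0 by rewrite gt_eqF// powR_gt0// subr_gt0.
by apply: (mulIf p_neq0); rewrite powRN mulVf.
Qed.

(** * Generating functions of the laws in play, and inversion of that of [NB1] *)

Lemma pgf_NB1 (R : realType) (r theta s : R) : 0 < r -> 0 < theta < 1 ->
  0 <= s <= 1 -> pgf (NB1 r theta) s = ((1 - theta) / (1 - theta * s)) `^ r.
Proof.
move=> r_gt0 /andP[th_gt0 th_lt1]; move: s.
have r_ge0 := ltW r_gt0.
(* The negative binomial mass function, with generating series (1 - theta)^r f_r(theta s). *)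
apply: (@pgf_law_with_pgf _ (fun k => (1 - theta) `^ r * (nb_coef r k * theta ^+ k))).
- by move=> k; rewrite !mulr_ge0 ?powR_ge0 ?nb_coef_ge0// exprn_ge0// ltW.
- by rewrite mulr1 divff ?powR1// gt_eqF// subr_gt0.
move=> s /andP[s_ge0 s_le1].
have ths_ge0 : 0 <= theta * s by rewrite mulr_ge0// ltW.
have ths_lt1 : theta * s < 1 by nra.
rewrite (_ : series _ = (fun n => (1 - theta) `^ r * pseries (nb_coef r) (theta * s) n)).
  rewrite powRM ?invr_ge0 ?subr_ge0// 1?ltW//.
  rewrite -[(1 - theta * s)^-1]powR_inv1 ?subr_ge0// 1?ltW// -powRrM mulN1r.
  rewrite -lim_pseries_nb_coef//; apply: cvgMr.
  exact: is_cvg_pseries_nb_coef.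
apply/funext => n; rewrite /pseries /series /= mulr_sumr.
by apply: eq_bigr => i _; rewrite exprMn !mulrA.
Qed.

Lemma counting_pgf_odot (R : realType) (beta theta s : R) :
  0 < beta < 1 -> 0 < theta < 1 -> 0 <= s <= 1 ->
  counting_pgf (odot beta theta) s = odot_pgf beta theta s.
Proof.
move=> /andP[b_gt0 b_lt1] /andP[th_gt0 th_lt1]; move: s.
set c := (1 - beta) * theta.
have c_ge0 : 0 <= c by rewrite /c; nra.
have c_lt1 : c < 1 by rewrite /c; nra.
(* Mass 1 - beta at 0; the remaining mass beta is geometric of ratio c on k >= 1. *)
apply: (@pgf_law_with_pgf _
  (fun k => if k is j.+1 then beta * (1 - c) * c ^+ j else 1 - beta)).
- move=> [|k]; first by rewrite subr_ge0 ltW.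
  by rewrite !mulr_ge0 ?exprn_ge0 ?subr_ge0// ltW.
- by rewrite /odot_pgf subrr mul0r mulr0 subr0.
move=> s /andP[s_ge0 s_le1]; rewrite -cvg_shiftS.
have cs_lt1 : c * s < 1 by nra.
have -> : odot_pgf beta theta s = 1 - beta + beta * (1 - c) * s / (1 - c * s).
  by rewrite /odot_pgf -/c; field; rewrite gt_eqF// subr_gt0.
rewrite (_ : (fun n => _) = (fun n => 1 - beta +
    series (geometric (beta * (1 - c) * s) (c * s)) n)).
  apply: cvgD; first exact: cvg_cst.
  by apply: cvg_geometric_series; rewrite ger0_norm// mulr_ge0.
apply/funext => n; rewrite /series /= big_nat_recl// expr0 mulr1.
congr (_ + _); apply: eq_bigr => i _.
by rewrite /geometric /= exprS [(c * s) ^+ _]exprMn; ring.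
Qed.

Lemma star_pgf_NB1 (R : realType) (r beta theta s : R) :
  0 < r -> 0 < beta < 1 -> 0 < theta < 1 -> 0 <= s <= 1 ->
  star_pgf (NB1 r theta) (NB1 r ((1 - beta) * theta)) s = odot_pgf beta theta s.
Proof.
move=> r_gt0 /andP[b_gt0 b_lt1] /andP[th_gt0 th_lt1] s01.
have /andP[s_ge0 s_le1] := s01.
set c := (1 - beta) * theta; set t := odot_pgf beta theta s.
have c01 : 0 < c < 1 by rewrite /c; apply/andP; split; nra.
have th01 : 0 < theta < 1 by rewrite th_gt0.
have D_gt0 (q u : R) : 0 < q < 1 -> 0 <= u <= 1 -> 0 < 1 - q * u.
  by move=> /andP[? ?] /andP[? ?]; nra.
have Dc := D_gt0 c s c01 s01; have Ds := D_gt0 theta s th01 s01.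
(* Both bounds follow from (1 - s) / (1 - c s) lying in [0, 1]. *)
have t01 : 0 <= t <= 1.
  have q0 : 0 <= (1 - s) / (1 - c * s) by rewrite divr_ge0 ?(ltW Dc)// subr_ge0.
  have q1 : (1 - s) / (1 - c * s) <= 1.
    by rewrite ler_pdivrMr// mul1r lerD2l lerN2 ler_piMl// ltW//; case/andP: c01.
  rewrite /t /odot_pgf -/c subr_ge0 gerBl mulr_ge0 ?(ltW b_gt0)// andbT.
  by rewrite mulr_ile1 ?(ltW b_gt0) ?(ltW b_lt1).
have Dt := D_gt0 theta t th01 t01.
have q_ge0 (q u : R) : 0 < q < 1 -> 0 <= u <= 1 -> 0 <= (1 - q) / (1 - q * u).
  move=> q01 u01; rewrite divr_ge0// ?(ltW (D_gt0 _ _ q01 u01))//.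
  by case/andP: q01 => _ /ltW; rewrite subr_ge0.
have pgf_t : pgf (NB1 r theta) s / pgf (NB1 r c) s = pgf (NB1 r theta) t.
  rewrite !pgf_NB1//.
  (* The bases of the powers factor, so the power for c cancels against the pgf of the
     innovation. *)
  rewrite (_ : (1 - theta) / (1 - theta * s) =
    (1 - theta) / (1 - theta * t) * ((1 - c) / (1 - c * s))).
    rewrite powRM ?q_ge0// mulfK// powR_eq0 negb_and gt_eqF// divr_gt0//.
    by rewrite subr_gt0; case/andP: c01.
  have -> : 1 - theta * t = (1 - c) * (1 - theta * s) / (1 - c * s).
    rewrite /t /odot_pgf /c; field.
    by rewrite gt_eqF.
  field.
  by rewrite !gt_eqF//= subr_gt0; case/andP: c01.
rewrite /star_pgf pgf_t /pgf_inv pinvKV ?inE//=.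
(* Injectivity on [0, 1]: strip the power r, the factor 1 - theta, the inverse, then the affine
   map. *)
move=> u v; rewrite !inE /= !in_itv /= => u01 v01.
rewrite !pgf_NB1// => /(powR_injective r_gt0).
have u_gt0 := D_gt0 theta u th01 u01; have v_gt0 := D_gt0 theta v th01 v01.
rewrite !nnegrE !q_ge0// => /(_ isT isT) /(mulfI _) uv.
have /invr_inj : (1 - theta * u)^-1 = (1 - theta * v)^-1.
  by apply: uv; rewrite gt_eqF// subr_gt0.
by move=> /addrI /oppr_inj /mulfI; apply; rewrite gt_eqF.
Qed.

Theorem lemma4p1 (R : realType) (r : R) (hr : 0 < r) :
  (* (i) *)
  (forall beta theta : R, 0 < beta < 1 -> 0 < theta < 1 ->
    (forall s : R, 0 <= s <= 1 ->
      counting_pgf (star_NB1 r beta theta) s =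
        star_pgf (NB1 r theta) (NB1 r ((1 - beta) * theta)) s
      /\ star_pgf (NB1 r theta) (NB1 r ((1 - beta) * theta)) s =
        1 - beta * ((1 - s) / (1 - (1 - beta) * theta * s))
      /\ counting_pgf (odot beta theta) s =
        1 - beta * ((1 - s) / (1 - (1 - beta) * theta * s)))
    /\ identical (odot beta theta) (star_NB1 r beta theta))
  /\
  (* (ii) *)
  (forall alpha mu : R, 0 < alpha < 1 -> 0 < mu ->
    let beta := alpha * r / (r + (1 - alpha) * mu) in
    let theta := mu / (mu + r) in
    [/\ 0 < beta < 1, 0 < theta < 1,
        identical (star3 alpha mu r) (star_NB1 r beta theta)
      & identical (star3 alpha mu r) (odot beta theta)])
  /\
  (* (ii), converse *)
  (forall beta theta : R, 0 < beta < 1 -> 0 < theta < 1 ->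
    let alpha := beta / (1 - (1 - beta) * theta) in
    let mu := theta * r / (1 - theta) in
    [/\ 0 < alpha < 1, 0 < mu,
        identical (star_NB1 r beta theta) (star3 alpha mu r)
      & identical (odot beta theta) (star3 alpha mu r)]).
Proof.
(* The operators are equal as records, which gives [identical] by rewriting. *)
have starE beta theta : 0 < beta < 1 -> 0 < theta < 1 ->
    star_NB1 r beta theta = odot beta theta.
  move=> b01 th01; congr Thinning; apply: eq_law_with_pgf => s s01.
  exact: star_pgf_NB1.
have star3E alpha mu beta theta :
    (forall s, 0 <= s <= 1 -> star3_pgf alpha mu r s = odot_pgf beta theta s) ->
    star3 alpha mu r = odot beta theta.
  by move=> E; congr Thinning; exact: eq_law_with_pgf.
split; last split.
- move=> beta theta b01 th01; split=> [s s01|]; last by rewrite starE.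
  by rewrite starE// counting_pgf_odot// star_pgf_NB1.
- move=> alpha mu /andP[a_gt0 a_lt1] mu_gt0 beta theta.
  have d_gt0 : 0 < r + (1 - alpha) * mu by nra.
  have b01 : 0 < beta < 1.
    by rewrite /beta divr_gt0 ?mulr_gt0//= ltr_pdivrMr// mul1r; nra.
  have th01 : 0 < theta < 1.
    by rewrite /theta divr_gt0 ?addr_gt0//= ltr_pdivrMr ?addr_gt0// mul1r; lra.
  have E : star3 alpha mu r = odot beta theta.
    apply: star3E => s /andP[s_ge0 s_le1]; rewrite /star3_pgf /odot_pgf.
    have D_gt0 : 0 < r + (1 - alpha) * mu * (1 - s).
      by rewrite ltr_pwDl// !mulr_ge0// ?subr_ge0// ltW.
    (* Here (1 - beta) theta = (1 - alpha) mu / (r + (1 - alpha) mu). *)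
    have -> : 1 - (1 - beta) * theta * s =
        (r + (1 - alpha) * mu * (1 - s)) / (r + (1 - alpha) * mu).
      by rewrite /beta /theta; field; rewrite !gt_eqF// addr_gt0.
    have -> : 1 + r^-1 * (1 - alpha) * mu * (1 - s) =
        (r + (1 - alpha) * mu * (1 - s)) / r.
      by field; rewrite gt_eqF.
    by rewrite /beta; field; rewrite !gt_eqF.
  by split=> //; rewrite E ?starE.
move=> beta theta /[dup] b01 /andP[b_gt0 b_lt1] /[dup] th01 /andP[th_gt0 th_lt1] alpha mu.
have d_gt0 : 0 < 1 - (1 - beta) * theta by nra.
have th1 : 0 < 1 - theta by rewrite subr_gt0.
have E : star3 alpha mu r = odot beta theta.
  apply: star3E => s /andP[s_ge0 s_le1]; rewrite /star3_pgf /odot_pgf.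
  have D_gt0 : 0 < 1 - (1 - beta) * theta * s.
    apply: lt_le_trans d_gt0 _; rewrite lerD2l lerN2.
    by rewrite ler_piMr// mulr_ge0 ?subr_ge0// ltW.
  (* With c = (1 - beta) theta, the parameters satisfy (1 - alpha) mu / r = c / (1 - c). *)
  have -> : 1 + r^-1 * (1 - alpha) * mu * (1 - s) =
      (1 - (1 - beta) * theta * s) / (1 - (1 - beta) * theta).
    by rewrite /alpha /mu; field; rewrite !gt_eqF.
  by rewrite /alpha; field; rewrite !gt_eqF.
split; rewrite ?E ?starE//.
- by rewrite /alpha divr_gt0//= ltr_pdivrMr// mul1r; nra.
- by rewrite /mu divr_gt0// mulr_gt0.
Qed.
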